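(* Let $R$ be an (associative, not necessarily unital) ring. (i) If $R$ is dense, then $\Lambda(R)$ is a $\mathrm{Cu}$-semigroup, and $\prec\,=\,\ll$ on $\Lambda(R)$. (ii) If $R$ is left normal, then $\mathrm S(R)$ is a $\mathrm{Cu}$-semigroup, and $\prec\,=\,\ll$ on $\mathrm S(R)$.
   Context: $M_\infty(R)$ is the ring of infinite matrices over $R$ with finitely many nonzero entries. For $x,y\in M_\infty(R)$, $x\precsim_1 y$ means $x=syt$ for some $s,t\in M_\infty(R)$. $x\oplus y$ denotes the infinite matrix represented by the block diagonal matrix $\mathrm{diag}(x,y)$, where $x,y$ are replaced by finite square upper-left corners containing all their nonzero entries. $T(R)=\{(x_n)_{n\ge1}: x_n\in M_\infty(R),\ x_n\precsim_1 x_{n+1}\ \forall n\}$, and $\mathcal S(R)=\{(x_n)\in T(R): \forall n\ \exists y_{n+1}\in M_\infty(R),\ x_n=y_{n+1}x_{n+1}x_n\}$. For $(x_n),(y_n)\in T(R)$ write $(x_n)\precsim(y_n)$ if for every $n$ there is $m$ with $x_n\precsim_1 y_m$, and $(x_n)\sim(y_n)$ if $(x_n)\precsim (y_n)$ and $(y_n)\precsim(x_n)$. Put $\Lambda(R)=T(R)/{\sim}$ and $\mathrm S(R)=\mathcal S(R)/{\sim}\subseteq\Lambda(R)$, with the order induced by $\precsim$ and addition $[(x_n)]+[(y_n)]=[(x_n\oplus y_n)]$; these are positively ordered commutative monoids. On both $\Lambda(R)$ and $\mathrm S(R)$, $[(x_n)]\prec[(y_n)]$ means that there is $m$ with $x_n\precsim_1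 y_m$ for all $n$. $R$ is dense if whenever $x\precsim_1 y$ in $M_\infty(R)$ there is $z\in M_\infty(R)$ with $x\precsim_1 z\precsim_1 y$. $R$ is left normal if for all $a,b,c\in M_\infty(R)$ with $a=ba$ and $b=cb$ there exist $d,e\in M_\infty(R)$ with $a=da$, $d=ed$, $e=ce$. In a partially ordered set where increasing sequences have suprema, $x\ll y$ means: for every increasing sequence $(z_n)$ with $y\le\sup_n z_n$ there is $m$ with $x\le z_m$. A $\mathrm{Cu}$-semigroup is a positively ordered monoid $S$ satisfying: (O1) increasing sequences have suprema; (O2) every element is the supremum of a sequence $(x_n)$ with $x_n\ll x_{n+1}$ for all $n$; (O3) $x'\ll x$, $y'\ll y$ imply $x'+y'\ll x+y$; (O4) $\sup_n(x_n+y_n)=\sup_n x_n+\sup_n y_n$ for increasing sequences. *)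

(* Defs.v *)
From HB Require Import structures.
From mathcomp Require Import all_boot all_order all_algebra.
From mathcomp Require Import finmap boolp classical_sets.

Set Implicit Arguments.
Unset Strict Implicit.
Unset Printing Implicit Defensive.

Import Order.TTheory GRing.Theory.

Local Open Scope ring_scope.
Local Open Scope quotient_scope.

Reserved Notation "x ** y" (at level 40, left associativity).
Reserved Notation "x <~1 y" (at level 70, no associativity).

(* MathComp's ring structures all have a unit, so they do not cover the rings
   considered here. *)
HB.mixin Record Zmodule_isNonUnitalRing R of GRing.Zmodule R := {
  nmul : R -> R -> R;
  nmulA : associative nmul;
  nmulDl : left_distributive nmul +%R;
  nmulDr : right_distributive nmul +%R
}.

#[short(type="nonUnitalRingType")]
HB.structure Definition NonUnitalRing :=
  {R of Zmodule_isNonUnitalRing R & GRing.Zmodule R}.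

Notation "x ** y" := (nmul x y) : ring_scope.

Section NonUnitalRingTheory.
Variable R : nonUnitalRingType.
Implicit Types x y : R.

Lemma nmul0r x : 0 ** x = 0.
Proof. by apply: (addIr (0 ** x)); rewrite -nmulDl !add0r. Qed.

Lemma nmulr0 x : x ** 0 = 0.
Proof. by apply: (addIr (x ** 0)); rewrite -nmulDr !add0r. Qed.

Lemma nmul_suml I (r : seq I) (F : I -> R) x :
  (\sum_(i <- r) F i) ** x = \sum_(i <- r) F i ** x.
Proof. by apply: (big_morph (fun y => y ** x)) => [? ?|]; rewrite (nmulDl, nmul0r). Qed.

Lemma nmul_sumr I (r : seq I) (F : I -> R) x :
  x ** (\sum_(i <- r) F i) = \sum_(i <- r) x ** F i.
Proof. by apply: (big_morph (fun y => x ** y)) => [? ?|]; rewrite (nmulDr, nmulr0). Qed.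

End NonUnitalRingTheory.

Definition Minf (R : zmodType) := {fsfun nat * nat -> R with 0}.

HB.instance Definition _ (R : zmodType) := Choice.on (Minf R).

Section MinfZmodule.
Variable R : zmodType.
Implicit Types x y : Minf R.

(* The size of the smallest square upper-left corner of [x] that contains all
   the nonzero entries of [x]. *)
Definition mxsize x : nat := (\max_(p <- finsupp x) (maxn p.1 p.2).+1)%N.

Definition corner n x : 'M[R]_n := \matrix_(i, j) x (val i, val j).

Definition of_corner n (A : 'M[R]_n) : Minf R :=
  [fsfun p in [fset (val ij.1, val ij.2) | ij in {: 'I_n * 'I_n}]%fset =>
     if (insub p.1, insub p.2) is (Some i, Some j) then A i j else 0].

Definition Minf_add x y : Minf R :=
  [fsfun p in (finsupp x `|` finsupp y)%fset => x p + y p].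
Definition Minf_opp x : Minf R := [fsfun p in finsupp x => - x p].

Lemma Minf_addE x y p : Minf_add x y p = x p + y p.
Proof.
rewrite fsfunE inE; case: finsuppP => [_|//]; case: finsuppP => [_|//].
by rewrite addr0.
Qed.

Lemma Minf_oppE x p : Minf_opp x p = - x p.
Proof. by rewrite fsfunE; case: finsuppP => //; rewrite oppr0. Qed.

Fact Minf_addA : associative Minf_add.
Proof. by move=> x y z; apply/fsfunP => p; rewrite !Minf_addE addrA. Qed.
Fact Minf_addC : commutative Minf_add.
Proof. by move=> x y; apply/fsfunP => p; rewrite !Minf_addE addrC. Qed.
Fact Minf_add0 : left_id ([fsfun] : Minf R) Minf_add.
Proof. by move=> x; apply/fsfunP => p; rewrite Minf_addE fsfunE add0r. Qed.
Fact Minf_addN : left_inverse ([fsfun] : Minf R) Minf_opp Minf_add.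
Proof. by move=> x; apply/fsfunP => p; rewrite Minf_addE Minf_oppE fsfunE addNr. Qed.

HB.instance Definition _ :=
  GRing.isZmodule.Build (Minf R) Minf_addA Minf_addC Minf_add0 Minf_addN.

Lemma Minf0E p : (0 : Minf R) p = 0. Proof. by rewrite fsfunE. Qed.
Lemma MinfDE x y p : (x + y) p = x p + y p. Proof. exact: Minf_addE. Qed.

Lemma of_cornerE n (F : nat -> nat -> R) i j :
  of_corner (\matrix_(i < n, j < n) F i j) (i, j) =
  if (i < n)%N && (j < n)%N then F i j else 0.
Proof.
rewrite fsfunE /=; case: imfsetP => [[[a b] _ [-> ->]]|nij] /=.
  by rewrite !ltn_ord !valK mxE.
case: ifP => // /andP[ni nj]; case: nij.
by exists (Ordinal ni, Ordinal nj).
Qed.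

Lemma ltn_mxsize x p : x p != 0 -> (p.1 < mxsize x)%N && (p.2 < mxsize x)%N.
Proof.
move=> xp; rewrite /mxsize -gtn_max.
by apply: (@leq_bigmax_seq _ _ _ (fun p => (maxn p.1 p.2).+1)); rewrite ?mem_finsupp.
Qed.

Lemma mxsize_out x i j : (mxsize x <= i)%N || (mxsize x <= j)%N -> x (i, j) = 0.
Proof.
move=> xij; apply/eqP; apply: contraLR xij => /ltn_mxsize /=.
by rewrite negb_or -!ltnNge.
Qed.

Lemma of_corner_id n (x : Minf R) : (mxsize x <= n)%N -> of_corner (corner n x) = x.
Proof.
move=> xn; apply/fsfunP => -[i j]; rewrite (of_cornerE n (fun i j => x (i, j))).
case: ifP => // /negbT; rewrite negb_and -!leqNgt => nij.
by rewrite mxsize_out //; case/orP: nij => /(leq_trans xn) ->; rewrite ?orbT.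
Qed.

Lemma mxsizeP x n : (forall i j, (n <= i)%N || (n <= j)%N -> x (i, j) = 0) ->
  (mxsize x <= n)%N.
Proof.
move=> xn; apply/bigmax_leqP_seq => -[i j]; rewrite mem_finsupp => xij _ /=.
rewrite gtn_max; apply: contraR xij; rewrite negb_and -!leqNgt => /xn ->.
by rewrite eqxx.
Qed.

End MinfZmodule.

Lemma sum_widen (V : zmodType) (F : nat -> V) n m : (n <= m)%N ->
  (forall k, (n <= k)%N -> F k = 0) -> \sum_(k < m) F k = \sum_(k < n) F k.
Proof.
move=> nm F0; rewrite -!(big_mkord xpredT) (big_cat_nat (leq0n n) nm) //=.
rewrite [X in _ + X]big_nat_cond [X in _ + X]big1 ?addr0 //.
by move=> k /andP[/andP[/F0]].
Qed.

Section MinfRing.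
Variable R : nonUnitalRingType.
Implicit Types x y z : Minf R.

Definition Minf_mul x y : Minf R :=
  let n := maxn (mxsize x) (mxsize y) in
  of_corner (\matrix_(i < n, j < n)
    \sum_(k < n) x (val i, val k) ** y (val k, val j)).

Lemma Minf_mulE n x y i j : (mxsize x <= n)%N || (mxsize y <= n)%N ->
  Minf_mul x y (i, j) = \sum_(k < n) x (i, val k) ** y (val k, j).
Proof.
set N := maxn (mxsize x) (mxsize y) => xyn.
have sumE m : (mxsize x <= m)%N || (mxsize y <= m)%N ->
    \sum_(k < m) x (i, val k) ** y (val k, j) =
    \sum_(k < maxn m N) x (i, val k) ** y (val k, j).
  move=> xym; apply/esym.
  apply: (@sum_widen _ (fun k => x (i, k) ** y (k, j))); first exact: leq_maxl.
  by move=> k mk; case/orP: xym => /leq_trans/(_ mk) xyk;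
    [rewrite (@mxsize_out _ x) ?xyk ?orbT // nmul0r
    |rewrite (@mxsize_out _ y) ?xyk ?orbT // nmulr0].
rewrite /Minf_mul (of_cornerE _ (fun i j => \sum_(k < N) x (i, val k) ** y (val k, j))).
rewrite sumE //; case: ifP => [_|/negbT].
  rewrite maxnC; apply/esym.
  apply: (@sum_widen _ (fun k => x (i, k) ** y (k, j))); first exact: leq_maxl.
  move=> k; rewrite geq_max => /andP[xk _].
  by rewrite (@mxsize_out _ x) ?xk ?orbT // nmul0r.
rewrite negb_and -!leqNgt !geq_max => ij; apply/esym/big1 => k _.
case/orP: ij => /andP[xi yj].
  by rewrite (@mxsize_out _ x) ?xi // nmul0r.
by rewrite (@mxsize_out _ y) ?yj ?orbT // nmulr0.
Qed.

Lemma mxsize_mul n x y : (mxsize x <= n)%N -> (mxsize y <= n)%N ->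
  (mxsize (Minf_mul x y) <= n)%N.
Proof.
move=> xn yn; apply: mxsizeP => i j ij; rewrite (@Minf_mulE n) ?xn // big1 // => k _.
case/orP: ij => [/(leq_trans xn) xi|/(leq_trans yn) yj].
  by rewrite (@mxsize_out _ x) ?xi // nmul0r.
by rewrite (@mxsize_out _ y) ?yj ?orbT // nmulr0.
Qed.

Fact Minf_mulA : associative Minf_mul.
Proof.
move=> x y z; apply/fsfunP => -[i j].
pose n := maxn (mxsize x) (maxn (mxsize y) (mxsize z)).
have [xn yn zn] : [/\ (mxsize x <= n), (mxsize y <= n) & (mxsize z <= n)]%N.
  by split; rewrite !leq_max leqnn ?orbT.
rewrite (@Minf_mulE n) ?xn // (@Minf_mulE n) ?zn ?orbT //.
under eq_bigr => k _ do rewrite (@Minf_mulE n) ?yn // nmul_sumr.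
under [RHS]eq_bigr => k _ do rewrite (@Minf_mulE n) ?xn // nmul_suml.
rewrite exchange_big /=; apply: eq_bigr => k _; apply: eq_bigr => l _.
by rewrite nmulA.
Qed.

Fact Minf_mulDl : left_distributive Minf_mul +%R.
Proof.
move=> x y z; apply/fsfunP => -[i j].
rewrite MinfDE !(@Minf_mulE (mxsize z)) ?leqnn ?orbT // -big_split.
by apply: eq_bigr => k _; rewrite MinfDE nmulDl.
Qed.

Fact Minf_mulDr : right_distributive Minf_mul +%R.
Proof.
move=> z x y; apply/fsfunP => -[i j].
rewrite MinfDE !(@Minf_mulE (mxsize z)) ?leqnn ?orbT // -big_split.
by apply: eq_bigr => k _; rewrite MinfDE nmulDr.
Qed.

HB.instance Definition _ :=
  Zmodule_isNonUnitalRing.Build (Minf R) Minf_mulA Minf_mulDl Minf_mulDr.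

Lemma MinfME n x y i j : (mxsize x <= n)%N || (mxsize y <= n)%N ->
  (x ** y) (i, j) = \sum_(k < n) x (i, val k) ** y (val k, j).
Proof. exact: Minf_mulE. Qed.

End MinfRing.

Section Prec.
Variable R : nonUnitalRingType.
Implicit Types x y z : Minf R.

Definition prec1 x y : Prop := exists s t : Minf R, x = s ** y ** t.
Local Notation "x <~1 y" := (prec1 x y).

(* The block diagonal matrix diag(x, y), where [x] and [y] are replaced by
   their upper-left corners of sizes [a] and [b]. *)
Definition oplus_at (a b : nat) x y : Minf R :=
  of_corner (block_mx (corner a x) 0 0 (corner b y)).

(* Other corners give the same class in [Lambda R]: see [Lambda_add_oplus_at]. *)
Definition oplus x y : Minf R := oplus_at (mxsize x) (mxsize y) x y.

Lemma prec1_trans y x z : x <~1 y -> y <~1 z -> x <~1 z.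
Proof.
move=> [s [t ->]] [s' [t' ->]]; exists (s ** s'), (t' ** t).
by rewrite !nmulA.
Qed.

Lemma prec10 x : 0 <~1 x.
Proof. by exists 0, 0; rewrite nmulr0. Qed.

Definition sandwich n (s : nat -> nat -> R) y (t : nat -> nat -> R) i j : R :=
  \sum_(k < n) \sum_(l < n) s i k ** y (val k, val l) ** t l j.

Lemma sandwich_widen n m s y t i j : (mxsize y <= n)%N -> (n <= m)%N ->
  sandwich m s y t i j = sandwich n s y t i j.
Proof.
move=> yn nm; rewrite /sandwich.
rewrite (@sum_widen _ (fun k => \sum_(l < m) s i k ** y (k, val l) ** t l j) n) //.
  apply: eq_bigr => k _.
  apply: (@sum_widen _ (fun l => s i k ** y (val k, l) ** t l j)) => // l nl.
  by rewrite (@mxsize_out _ y) ?(leq_trans yn nl) ?orbT // nmulr0 nmul0r.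
move=> k nk; apply: big1 => l _.
by rewrite (@mxsize_out _ y) ?(leq_trans yn nk) // nmulr0 nmul0r.
Qed.

Definition of_fun n (F : nat -> nat -> R) : Minf R :=
  of_corner (\matrix_(i < n, j < n) F i j).

Lemma of_funE n F i j :
  of_fun n F (i, j) = if (i < n)%N && (j < n)%N then F i j else 0.
Proof. exact: of_cornerE. Qed.

Lemma mxsize_of_fun n F : (mxsize (of_fun n F) <= n)%N.
Proof.
apply: mxsizeP => i j ij; rewrite of_funE; case: ifP => // /andP[].
by rewrite !ltnNge; case/orP: ij => ->.
Qed.

Lemma nmul_sandwich n s y t i j :
  (mxsize s <= n)%N -> (mxsize y <= n)%N -> (mxsize t <= n)%N ->
  (s ** y ** t) (i, j) =
    sandwich n (fun i j => s (i, j)) y (fun i j => t (i, j)) i j.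
Proof.
move=> sn yn tn; rewrite (@MinfME _ n) ?tn ?orbT // /sandwich exchange_big /=.
by apply: eq_bigr => l _; rewrite (@MinfME _ n) ?sn // nmul_suml.
Qed.

Lemma sandwich_nmul n N x s y t : (mxsize y <= n)%N ->
  (forall i j, x (i, j) = sandwich n s y t i j) ->
  (n <= N)%N -> (mxsize x <= N)%N -> x = of_fun N s ** y ** of_fun N t.
Proof.
move=> yn xE nN xN; apply/fsfunP => -[i j].
rewrite (@nmul_sandwich N) ?mxsize_of_fun ?(leq_trans yn) //.
have [iN|Ni] := ltnP i N; last first.
  rewrite mxsize_out ?(leq_trans xN Ni) //; apply/esym/big1 => k _.
  by apply: big1 => l _; rewrite of_funE ltnNge Ni /= !nmul0r.
have [jN|Nj] := ltnP j N; last first.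
  rewrite mxsize_out ?(leq_trans xN Nj) ?orbT //; apply/esym/big1 => k _.
  by apply: big1 => l _; rewrite !of_funE (ltnNge j) Nj andbF nmulr0.
rewrite xE -(@sandwich_widen n N) //.
by apply: eq_bigr => k _; apply: eq_bigr => l _; rewrite !of_funE iN jN !ltn_ord.
Qed.

Lemma prec1P x y : x <~1 y <-> exists s t,
  forall i j, x (i, j) = sandwich (mxsize y) s y t i j.
Proof.
split=> [[s [t ->]]|[s [t xE]]]; last first.
  by do 2!eexists; apply: (sandwich_nmul _ xE (leq_maxl _ (mxsize x)));
    rewrite ?leq_maxr.
exists (fun i j => s (i, j)), (fun i j => t (i, j)) => i j.
pose n := maxn (mxsize s) (maxn (mxsize y) (mxsize t)).
have [sn yn tn] : [/\ (mxsize s <= n), (mxsize y <= n) & (mxsize t <= n)]%N.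
  by split; rewrite !leq_max leqnn ?orbT.
by rewrite -(@sandwich_widen (mxsize y) n) // (@nmul_sandwich n).
Qed.

(* [f : nat -> nat + nat] splits the indices into those of two blocks, and
   [blk f g s s'] has the blocks [s] and [s'], with rows split by [f] and columns
   by [g]. *)
Definition blk (f g : nat -> nat + nat) (s s' : nat -> nat -> R) i k : R :=
  match f i, g k with
  | inl a, inl b => s a b
  | inr a, inr b => s' a b
  | _, _ => 0
  end.

Definition is_block f x y z : Prop :=
  forall i j, z (i, j) = blk f f (fun i j => x (i, j)) (fun i j => y (i, j)) i j.

Definition splits (f : nat -> nat + nat) n1 n2 : Prop := exists e1 e2,
  [/\ forall a, (a < n1)%N -> f (e1 a) = inl a,
      forall k a, f k = inl a -> k = e1 a,
      forall a, (a < n2)%N -> f (e2 a) = inr a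
    & forall k a, f k = inr a -> k = e2 a].

Definition sel (V : zmodType) (F G : nat -> V) (c : nat + nat) :=
  match c with inl a => F a | inr b => G b end.

Lemma splits_sum f n1 n2 : splits f n1 n2 -> exists N, forall M F G,
  (N <= M)%N -> (forall a, (n1 <= a)%N -> F a = 0 :> R) ->
  (forall a, (n2 <= a)%N -> G a = 0 :> R) ->
  \sum_(k < M) sel F G (f k) = \sum_(a < n1) F a + \sum_(a < n2) G a.
Proof.
move=> [e1 [e2 [f1 e1P f2 e2P]]].
exists (maxn (\max_(a < n1) (e1 a).+1) (\max_(a < n2) (e2 a).+1)) => M F G.
rewrite geq_max => /andP[/bigmax_leqP M1 /bigmax_leqP M2] F0 G0.
have selE k : sel F G (f k) = \sum_(a < n1) (if f k == inl (val a) then F a else 0)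
    + \sum_(a < n2) (if f k == inr (val a) then G a else 0).
  case: (f k) => a /=.
    rewrite [X in _ + X]big1 ?addr0 //; have [an|na] := ltnP a n1.
      rewrite (bigD1 (Ordinal an)) //= eqxx big1 ?addr0 // => b ba.
      by case: (inl a =P _) => // -[ab]; move: ba; rewrite -val_eqE /= ab eqxx.
    rewrite F0 // big1 // => b _; case: eqP => // -[ab].
    by move: na; rewrite ab leqNgt ltn_ord.
  rewrite [X in X + _]big1 ?add0r //; have [an|na] := ltnP a n2.
    rewrite (bigD1 (Ordinal an)) //= eqxx big1 ?addr0 // => b ba.
    by case: (inr a =P _) => // -[ab]; move: ba; rewrite -val_eqE /= ab eqxx.
  rewrite G0 // big1 // => b _; case: eqP => // -[ab].
  by move: na; rewrite ab leqNgt ltn_ord.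
under eq_bigr do rewrite selE.
rewrite big_split /= exchange_big [X in _ + X = _]exchange_big /=.
congr (_ + _); apply: eq_bigr => a _.
  rewrite (bigD1 (Ordinal (M1 a isT))) //= f1 // eqxx big1 ?addr0 // => k.
  by case: (f k =P inl _) => // /e1P ka; rewrite -val_eqE /= ka eqxx.
rewrite (bigD1 (Ordinal (M2 a isT))) //= f2 // eqxx big1 ?addr0 // => k.
by case: (f k =P inr _) => // /e2P ka; rewrite -val_eqE /= ka eqxx.
Qed.

Lemma blk_sandwich f g s s' t t' y y' z :
  is_block g y y' z -> splits g (mxsize y) (mxsize y') ->
  exists2 n, (mxsize z <= n)%N & forall i j,
  sandwich n (blk f g s s') z (blk g f t t') i j =
    blk f f (sandwich (mxsize y) s y t) (sandwich (mxsize y') s' y' t') i j.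
Proof.
move=> zE /splits_sum[N sumE]; exists (maxn N (mxsize z)); first exact: leq_maxr.
move: (leq_maxl N (mxsize z)); set n := maxn _ _ => Nn i j.
pose n1 := mxsize y; pose n2 := mxsize y'.
transitivity (\sum_(k < n) sel
   (fun a => \sum_(l < n) sel
      (fun b => blk f inl s s' i a ** y (a, b) ** blk inl f t t' b j)
      (fun=> 0) (g l))
   (fun a => \sum_(l < n) sel (fun=> 0)
      (fun b => blk f inr s s' i a ** y' (a, b) ** blk inr f t t' b j)
      (g l)) (g k)).
  apply: eq_bigr => k _; rewrite /sel; case gk: (g k) => [a|a] /=;
    apply: eq_bigr => l _; rewrite zE /blk gk; case: (g l) => b //=;
    by rewrite ?nmulr0 ?nmul0r.
rewrite sumE //; last 2 first.
- move=> a na; apply: big1 => l _; case: (g l) => b //=.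
  by rewrite (@mxsize_out _ y) ?na // nmulr0 nmul0r.
- move=> a na; apply: big1 => l _; case: (g l) => b //=.
  by rewrite (@mxsize_out _ y') ?na // nmulr0 nmul0r.
under eq_bigr => a _.
  rewrite sumE //; last first.
    by move=> b nb; rewrite (@mxsize_out _ y) ?nb ?orbT // nmulr0 nmul0r.
  rewrite [X in _ + X]big1 // addr0; over.
under [X in _ + X]eq_bigr => a _.
  rewrite sumE //; last first.
    by move=> b nb; rewrite (@mxsize_out _ y') ?nb ?orbT // nmulr0 nmul0r.
  rewrite [X in X + _]big1 // add0r; over.
rewrite /blk /sandwich; case: (f i) => a; case: (f j) => b /=.
- rewrite [X in _ + X]big1 ?addr0 // => k _; apply: big1 => l _.
  by rewrite nmulr0.
- by rewrite !big1 ?addr0 // => k _; apply: big1 => l _; rewrite ?nmulr0 ?nmul0r ?nmul0r.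
- by rewrite !big1 ?addr0 // => k _; apply: big1 => l _; rewrite ?nmulr0 ?nmul0r ?nmul0r.
- rewrite [X in X + _]big1 ?add0r // => k _; apply: big1 => l _.
  by rewrite nmulr0.
Qed.

Lemma block_prec1 f g x x' y y' z w :
  is_block f x x' z -> is_block g y y' w -> splits g (mxsize y) (mxsize y') ->
  x <~1 y -> x' <~1 y' -> z <~1 w.
Proof.
move=> zE wE gs /prec1P[s [t xE]] /prec1P[s' [t' xE']].
have [n wn zwE] := blk_sandwich f s s' t t' wE gs.
apply/prec1P; exists (blk f g s s'), (blk g f t t') => i j.
rewrite -(@sandwich_widen (mxsize w) n) // zwE zE /blk.
by case: (f i) => a; case: (f j) => b //.
Qed.

Definition dec (a k : nat) : nat + nat :=
  if (k < a)%N then inl k else inr (k - a)%N.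

Lemma dec_splits a n1 n2 : (n1 <= a)%N -> splits (dec a) n1 n2.
Proof.
move=> na; exists id, (addn a); split => [b bn|k b|b _|k b]; rewrite /dec.
- by rewrite (leq_trans bn na).
- by case: ifP => // _ [].
- by rewrite ltnNge leq_addr addKn.
- by case: ltnP => // ak [<-]; rewrite subnKC.
Qed.

Definition swap (c : nat + nat) : nat + nat :=
  match c with inl a => inr a | inr a => inl a end.

Lemma swap_splits f n1 n2 : splits f n1 n2 -> splits (swap \o f) n2 n1.
Proof.
move=> [e1 [e2 [f1 e1P f2 e2P]]]; exists e2, e1; split => [a /f2|k a|a /f1|k a] /=.
- by move=> ->.
- by case E: (f k) => [?|b] //= -[<-]; apply: e2P.
- by move=> ->.
- by case E: (f k) => [b|?] //= -[<-]; apply: e1P.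
Qed.

Lemma swap_block f x y z : is_block f x y z -> is_block (swap \o f) y x z.
Proof. by move=> zE i j; rewrite zE /blk /=; case: (f i); case: (f j). Qed.

Lemma oplus_atE a b x y i j : oplus_at a b x y (i, j) =
  if (i < a + b)%N && (j < a + b)%N then
    blk (dec a) (dec a) (fun i j => x (i, j)) (fun i j => y (i, j)) i j else 0.
Proof.
rewrite -(of_cornerE (a + b)); congr (fun_of_fsfun (of_corner _) _).
apply/matrixP => k l; rewrite !mxE /blk /dec.
case: splitP => k' ->; rewrite !mxE; case: splitP => l' lE; rewrite !mxE;
  by rewrite ?lE ?ltn_ord ?ltnNge ?leq_addr ?addKn.
Qed.

Lemma oplus_at_block a b x y : (mxsize y <= b)%N ->
  is_block (dec a) x y (oplus_at a b x y).
Proof.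
move=> yb i j; rewrite oplus_atE; case: ifP => // /negbT.
rewrite negb_and -!leqNgt /blk /dec => ij.
case: ltnP => ai; case: ltnP => aj //=.
  by case/orP: ij => /(leq_trans (leq_addr _ _)); rewrite leqNgt ?ai ?aj.
apply/esym/mxsize_out/orP; case/orP: ij => ij; [left|right];
  by apply: (leq_trans yb); rewrite leq_subRL.
Qed.

Lemma oplus_block x y : is_block (dec (mxsize x)) x y (oplus x y).
Proof. exact: oplus_at_block. Qed.

Lemma mxsize_oplus_at a b x y : (mxsize (oplus_at a b x y) <= a + b)%N.
Proof.
apply: mxsizeP => i j ij; rewrite oplus_atE; case: ifP => // /andP[].
by rewrite !ltnNge; case/orP: ij => ->.
Qed.

Lemma oplus_prec1 x x' y y' : x <~1 y -> x' <~1 y' -> oplus x x' <~1 oplus y y'.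
Proof.
move=> xy xy'; apply: block_prec1 xy xy'; try exact: oplus_block.
exact: dec_splits.
Qed.

Lemma oplus0 x : oplus 0 x = x.
Proof.
have z0 : mxsize (0 : Minf R) = 0%N.
  by apply/eqP; rewrite -leqn0; apply: mxsizeP => i j _; rewrite Minf0E.
by apply/fsfunP => -[i j]; rewrite oplus_block z0 /blk /dec /= !subn0.
Qed.

Lemma oplus_atA a b c x y z : (mxsize y <= b)%N -> (mxsize z <= c)%N ->
  oplus_at a (b + c) x (oplus_at b c y z) = oplus_at (a + b) c (oplus_at a b x y) z.
Proof.
move=> yb zc; apply/fsfunP => -[i j].
rewrite oplus_at_block ?mxsize_oplus_at // oplus_at_block // /blk /dec.
have dE k : (a <= k)%N -> (k < a + b)%N = (k - a < b)%N.
  by move=> ak; rewrite ltn_subLR.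
case: (ltnP i a) => ia; case: (ltnP j a) => ja /=.
- by rewrite !ltn_addr //= oplus_at_block // /blk /dec ia ja.
- rewrite (ltn_addr _ ia) dE //; case: ifP => // jb.
  by rewrite oplus_at_block // /blk /dec ia ltnNge ja.
- rewrite (ltn_addr _ ja) dE //; case: ifP => // jb.
  by rewrite oplus_at_block // /blk /dec ja ltnNge ia.
- rewrite oplus_at_block // /blk /dec !dE //.
  case: ifP => ib; case: ifP => jb //.
  + by rewrite oplus_at_block // /blk /dec !ltnNge ia ja.
  + by rewrite !subnDA.
Qed.

End Prec.

Notation "x <~1 y" := (prec1 x y) : ring_scope.

Section CuSemigroup.
Local Open Scope order_scope.

Definition increasing d (P : porderType d) (z : nat -> P) : Prop :=
  {homo z : m n / (m <= n)%N >-> m <= n}.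

Definition is_sup d (P : porderType d) (z : nat -> P) (s : P) : Prop :=
  supremums (range z) s.

(* In a poset where every increasing sequence has a supremum [s], this is the
   sequential way-below relation. *)
Definition way_below d (P : porderType d) (x y : P) : Prop :=
  forall (z : nat -> P) (s : P), increasing z -> is_sup z s -> y <= s ->
  exists m, x <= z m.

Record pos_monoid d (S : porderType d) (zero : S) (add : S -> S -> S) : Prop := {
  pos_monoidA : associative add;
  pos_monoidC : commutative add;
  pos_monoid0 : left_id zero add;
  pos_monoid_ge0 : forall x, zero <= x;
  pos_monoid_le2r : forall z x y, x <= y -> add x z <= add y z
}.

Record Cu_semigroup d (S : porderType d) (zero : S) (add : S -> S -> S) : Prop := {
  Cu_pos_monoid : pos_monoid zero add;
  Cu_O1 : forall z : nat -> S, increasing z -> exists s, is_sup z s;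
  Cu_O2 : forall x : S, exists z : nat -> S,
    (forall n, way_below (z n) (z n.+1)) /\ is_sup z x;
  Cu_O3 : forall x' x y' y : S, way_below x' x -> way_below y' y ->
    way_below (add x' y') (add x y);
  Cu_O4 : forall (x y : nat -> S) (s t : S), increasing x -> increasing y ->
    is_sup x s -> is_sup y t -> is_sup (fun n => add (x n) (y n)) (add s t)
}.

End CuSemigroup.

Section Lambda.
Variable R : nonUnitalRingType.

(* Sequences are indexed from 0. *)
Definition T_set : set (nat -> Minf R) :=
  [set x | forall n, x n <~1 x n.+1]%classic.

Definition calS_set : set (nat -> Minf R) :=
  [set x | T_set x /\ forall n, exists y, x n = y ** x n.+1 ** x n]%classic.

Definition Tseq := set_type T_set.
HB.instance Definition _ := Choice.on Tseq.

Definition seq_prec (x y : nat -> Minf R) : Prop :=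
  forall n, exists m, x n <~1 y m.

Lemma TseqP (x : Tseq) n : val x n <~1 val x n.+1.
Proof. exact: (set_mem (valP x)). Qed.

Lemma Tseq_prec1 (x : Tseq) m n : (m < n)%N -> val x m <~1 val x n.
Proof.
elim: n => // n IHn; rewrite ltnS leq_eqVlt => /orP[/eqP ->|/IHn xmn].
  exact: TseqP.
exact: prec1_trans xmn (TseqP x n).
Qed.

Lemma seq_prec_refl (x : Tseq) : seq_prec (val x) (val x).
Proof. by move=> n; exists n.+1; apply: TseqP. Qed.

Lemma seq_prec_trans x y z : seq_prec x y -> seq_prec y z -> seq_prec x z.
Proof.
move=> xy yz n; have [m xym] := xy n; have [p yzp] := yz m.
by exists p; apply: prec1_trans xym yzp.
Qed.

Definition Tequiv : rel Tseq := fun x y =>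
  `[< seq_prec (val x) (val y) /\ seq_prec (val y) (val x) >].

Fact Tequiv_refl : reflexive Tequiv.
Proof. by move=> x; apply/asboolP; split; apply: seq_prec_refl. Qed.

Fact Tequiv_sym : symmetric Tequiv.
Proof. by move=> x y; apply/asboolP/asboolP => -[]. Qed.

Fact Tequiv_trans : transitive Tequiv.
Proof.
move=> y x z /asboolP[xy yx] /asboolP[yz zy]; apply/asboolP.
by split; [apply: seq_prec_trans xy yz|apply: seq_prec_trans zy yx].
Qed.

Canonical Tequiv_equivRel :=
  EquivRel Tequiv Tequiv_refl Tequiv_sym Tequiv_trans.

Definition Lambda := {eq_quot Tequiv}.
HB.instance Definition _ := Choice.on Lambda.
HB.instance Definition _ := EqQuotient.on Lambda.

Lemma LambdaP (x y : Tseq) : \pi_Lambda x = \pi_Lambda y <->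
  seq_prec (val x) (val y) /\ seq_prec (val y) (val x).
Proof. by split=> [/eqP|xy]; [|apply/eqP]; rewrite eqmodE; [move/asboolP|apply/asboolP]. Qed.

Lemma repr_seq_prec (x : Tseq) :
  seq_prec (val (repr (\pi_Lambda x))) (val x) /\
  seq_prec (val x) (val (repr (\pi_Lambda x))).
Proof. by apply/LambdaP; rewrite reprK. Qed.

(* The order, the relation, the zero and the addition are defined on chosen
   representatives; [Lambda_leE], [Lambda_precE] and [Lambda_add_oplus_at] say
   that any representatives can be used. *)
Definition Lambda_le (a b : Lambda) : bool :=
  `[< seq_prec (val (repr a)) (val (repr b)) >].

Definition Lambda_prec (a b : Lambda) : Prop :=
  exists m, forall n, val (repr a) n <~1 val (repr b) m.

Lemma Lambda_leP (x y : Tseq) :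
  reflect (seq_prec (val x) (val y)) (Lambda_le (\pi_Lambda x) (\pi_Lambda y)).
Proof.
have [rx xr] := repr_seq_prec x; have [ry yr] := repr_seq_prec y.
apply: (iffP (asboolP _)) => xy.
  exact: seq_prec_trans xr (seq_prec_trans xy ry).
exact: seq_prec_trans rx (seq_prec_trans xy yr).
Qed.

Lemma Lambda_precE (x y : Tseq) : Lambda_prec (\pi_Lambda x) (\pi_Lambda y) <->
  exists m, forall n, val x n <~1 val y m.
Proof.
have [rx xr] := repr_seq_prec x; have [ry yr] := repr_seq_prec y.
split=> -[m xym].
  have [p mp] := ry m; exists p => n; have [k nk] := xr n.
  exact: prec1_trans nk (prec1_trans (xym k) mp).
have [p mp] := yr m; exists p => n; have [k nk] := rx n.
exact: prec1_trans nk (prec1_trans (xym k) mp).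
Qed.

Fact Lambda_le_refl : reflexive Lambda_le.
Proof. by move=> a; apply/asboolP/seq_prec_refl. Qed.

Fact Lambda_le_anti : antisymmetric Lambda_le.
Proof.
move=> a b /andP[/asboolP ab /asboolP ba].
by rewrite -[a]reprK -[b]reprK; apply/LambdaP.
Qed.

Fact Lambda_le_trans : transitive Lambda_le.
Proof.
move=> b a c /asboolP ab /asboolP bc; apply/asboolP.
exact: seq_prec_trans ab bc.
Qed.

Fact Lambda_display : Order.disp_t. Proof. exact: Order.Disp tt tt. Qed.

HB.instance Definition _ := Order.Le_isPOrder.Build Lambda_display Lambda
  Lambda_le_refl Lambda_le_anti Lambda_le_trans.

Lemma Lambda_leE (x y : Tseq) :
  (\pi_Lambda x <= \pi_Lambda y)%O <-> seq_prec (val x) (val y).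
Proof. by split=> [/Lambda_leP|xy]; [|apply/Lambda_leP]. Qed.

Fact Tseq0_subproof : ((fun=> 0) : nat -> Minf R) \in T_set.
Proof. by apply/mem_set => n; apply: prec10. Qed.

Fact Tseq_add_subproof (x y : Tseq) : (fun n => oplus (val x n) (val y n)) \in T_set.
Proof. by apply/mem_set => n; apply: oplus_prec1; apply: TseqP. Qed.

Definition Tseq0 : Tseq :=
  exist (fun x => x \in T_set) _ Tseq0_subproof.
Definition Tseq_add (x y : Tseq) : Tseq :=
  exist (fun z => z \in T_set) _ (Tseq_add_subproof x y).

Definition Lambda0 : Lambda := \pi_Lambda Tseq0.
Definition Lambda_add (a b : Lambda) : Lambda := \pi_Lambda (Tseq_add (repr a) (repr b)).

Lemma block_seq_prec f g (x y z w : nat -> Minf R) (x' y' : Tseq) :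
  seq_prec x (val x') -> seq_prec y (val y') ->
  (forall n, is_block (f n) (x n) (y n) (z n)) ->
  (forall n, is_block (g n) (val x' n) (val y' n) (w n)) ->
  (forall n, splits (g n) (mxsize (val x' n)) (mxsize (val y' n))) ->
  seq_prec z w.
Proof.
move=> xx' yy' zE wE gs n; have [m xm] := xx' n; have [p yp] := yy' n.
exists (maxn m p).+1; apply: block_prec1 (zE n) (wE _) (gs _) _ _.
  by apply: prec1_trans xm (Tseq_prec1 _ _); rewrite ltnS leq_maxl.
by apply: prec1_trans yp (Tseq_prec1 _ _); rewrite ltnS leq_maxr.
Qed.

Lemma Lambda_addE_block f (x y z : Tseq) :
  (forall n, is_block (f n) (val x n) (val y n) (val z n)) ->
  (forall n, splits (f n) (mxsize (val x n)) (mxsize (val y n))) ->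
  Lambda_add (\pi_Lambda x) (\pi_Lambda y) = \pi_Lambda z.
Proof.
move=> zE fs; apply/LambdaP.
have [rx xr] := repr_seq_prec x; have [ry yr] := repr_seq_prec y.
split; [apply: block_seq_prec rx ry _ zE fs|apply: block_seq_prec xr yr zE _ _] => n.
- exact: oplus_block.
- exact: oplus_block.
- exact: dec_splits.
Qed.

Lemma Lambda_add_oplus_at (a b : nat -> nat) (x y z : Tseq) :
  (forall n, mxsize (val x n) <= a n)%N -> (forall n, mxsize (val y n) <= b n)%N ->
  (forall n, val z n = oplus_at (a n) (b n) (val x n) (val y n)) ->
  Lambda_add (\pi_Lambda x) (\pi_Lambda y) = \pi_Lambda z.
Proof.
move=> xa yb zE; apply: (@Lambda_addE_block (fun n => dec (a n))) => n.
  by rewrite zE; apply: oplus_at_block.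
exact: dec_splits.
Qed.

Lemma Lambda_add_pi (x y : Tseq) :
  Lambda_add (\pi_Lambda x) (\pi_Lambda y) = \pi_Lambda (Tseq_add x y).
Proof.
exact: (@Lambda_add_oplus_at (fun n => mxsize (val x n))
  (fun n => mxsize (val y n))).
Qed.

Fact Lambda_addC : commutative Lambda_add.
Proof.
move=> a b; rewrite -[a]reprK -[b]reprK [RHS]Lambda_add_pi.
apply: (@Lambda_addE_block (fun n => swap \o dec (mxsize (val (repr b) n)))) => n.
  exact/swap_block/oplus_block.
exact/swap_splits/dec_splits.
Qed.

Fact Lambda_addA : associative Lambda_add.
Proof.
move=> a b c; rewrite -[a]reprK -[b]reprK -[c]reprK.
move: (repr a) (repr b) (repr c) => x y z.
rewrite (Lambda_add_pi y z) (Lambda_add_pi x y).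
pose w n := oplus_at (mxsize (val x n)) (mxsize (val y n) + mxsize (val z n))
  (val x n) (oplus (val y n) (val z n)).
have wT : w \in T_set.
  apply/mem_set => n; apply: (block_prec1 (f := dec (mxsize (val x n)))
    (g := dec (mxsize (val x n.+1))) _ _ _ (TseqP x n) (TseqP (Tseq_add y z) n)).
  - exact/oplus_at_block/mxsize_oplus_at.
  - exact/oplus_at_block/mxsize_oplus_at.
  - exact: dec_splits.
transitivity (\pi_Lambda (exist (fun z => z \in T_set) w wT : Tseq)).
  apply: (@Lambda_add_oplus_at (fun n => mxsize (val x n))
    (fun n => mxsize (val y n) + mxsize (val z n))%N) => // n.
  exact: mxsize_oplus_at.
apply/esym/(@Lambda_add_oplus_at
    (fun n => mxsize (val x n) + mxsize (val y n))%N
    (fun n => mxsize (val z n))) => // n; first exact: mxsize_oplus_at.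
exact: oplus_atA.
Qed.

Fact Lambda_add0 : left_id Lambda0 Lambda_add.
Proof.
move=> a; rewrite -[a]reprK Lambda_add_pi; congr (\pi_Lambda _).
by apply/val_inj/funext => n /=; apply: oplus0.
Qed.

Fact Lambda_le0x (a : Lambda) : (Lambda0 <= a)%O.
Proof.
by rewrite -[a]reprK; apply/Lambda_leP => n; exists 0%N; apply: prec10.
Qed.

Fact Lambda_leD2r (c a b : Lambda) :
  (a <= b -> Lambda_add a c <= Lambda_add b c)%O.
Proof.
move=> /asboolP ab; apply/Lambda_leP.
apply: block_seq_prec ab (seq_prec_refl (repr c)) _ _ _ => n.
- exact: oplus_block.
- exact: oplus_block.
- exact: dec_splits.
Qed.

Lemma Lambda_pos_monoid : pos_monoid Lambda0 Lambda_add.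
Proof.
split; [exact: Lambda_addA|exact: Lambda_addC|exact: Lambda_add0
       |exact: Lambda_le0x|exact: Lambda_leD2r].
Qed.

(* S(R) as the subset of [Lambda R] of the classes that contain an element of
   [calS_set]. *)
Definition SR_set : set Lambda :=
  [set \pi_Lambda x | x in [set x : Tseq | calS_set (val x)]]%classic.

Definition evenodd (k : nat) : nat + nat := if odd k then inr k./2 else inl k./2.

Lemma evenodd_splits n1 n2 : splits evenodd n1 n2.
Proof.
exists double, (fun a => a.*2.+1); split => [a _|k a|a _|k a]; rewrite /evenodd.
- by rewrite odd_double doubleK.
- by case: ifP => // ok [<-]; rewrite -[LHS]odd_double_half ok.
- by rewrite /= odd_double uphalf_double.
- by case: ifP => // ok [<-]; rewrite -[LHS]odd_double_half ok.
Qed.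

Definition interleave (x y : Minf R) : Minf R :=
  of_fun (maxn (mxsize x) (mxsize y)).*2
    (blk evenodd evenodd (fun i j => x (i, j)) (fun i j => y (i, j))).

Lemma interleave_block x y : is_block evenodd x y (interleave x y).
Proof.
move=> i j; rewrite of_funE; case: ifP => // /negbT.
rewrite negb_and -!leqNgt => ij; apply/esym; rewrite /blk /evenodd.
have half_le k : ((maxn (mxsize x) (mxsize y)).*2 <= k ->
    (mxsize x <= k./2) && (mxsize y <= k./2))%N.
  by move=> /half_leq; rewrite doubleK geq_max.
by case: (odd i); case: (odd j) => //; apply/mxsize_out;
  case/orP: ij => /half_le/andP[xk yk]; rewrite ?xk ?yk ?orbT.
Qed.

Lemma interleave_absorb (x y x' y' : Minf R) :
  (exists s, x = s ** x' ** x) -> (exists s, y = s ** y' ** y) ->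
  exists s, interleave x y = s ** interleave x' y' ** interleave x y.
Proof.
have absorbE (u v s : Minf R) : u = s ** v ** u -> forall i j, u (i, j) =
    sandwich (mxsize v) (fun i j => s (i, j)) v (fun i j => u (i, j)) i j.
  move=> usv i j; rewrite {1}usv.
  pose n := maxn (mxsize s) (maxn (mxsize v) (mxsize u)).
  have [sn vn un] : [/\ (mxsize s <= n), (mxsize v <= n) & (mxsize u <= n)]%N.
    by split; rewrite !leq_max leqnn ?orbT.
  by rewrite -(@sandwich_widen _ (mxsize v) n) // (@nmul_sandwich _ n).
move=> [s /absorbE xE] [t /absorbE yE].
set z := interleave x y; set w := interleave x' y'.
have [n wn zE] := blk_sandwich evenodd (fun i j => s (i, j)) (fun i j => t (i, j))
  (fun i j => x (i, j)) (fun i j => y (i, j)) (interleave_block x' y')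
  (evenodd_splits _ _).
pose N := maxn n (mxsize z).
exists (of_fun N (blk evenodd evenodd (fun i j => s (i, j)) (fun i j => t (i, j)))).
rewrite -[X in _ ** X](@of_corner_id _ N) ?leq_maxr //.
apply: (sandwich_nmul (t := fun i j => z (i, j)) wn _ (leq_maxl _ _)
  (leq_maxr _ _)) => i j.
transitivity (blk evenodd evenodd (fun i j => x (i, j)) (fun i j => y (i, j)) i j).
  exact: interleave_block.
transitivity (blk evenodd evenodd
    (sandwich (mxsize x') (fun i j => s (i, j)) x' (fun i j => x (i, j)))
    (sandwich (mxsize y') (fun i j => t (i, j)) y' (fun i j => y (i, j))) i j).
  by rewrite /blk; case: (evenodd i) => a; case: (evenodd j) => b //.
rewrite -zE; apply: eq_bigr => k _; apply: eq_bigr => l _.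
by rewrite -(interleave_block x y).
Qed.

Fact Lambda0_in_SR : Lambda0 \in SR_set.
Proof.
apply/mem_set; exists Tseq0 => //; split=> [n|n] /=; first exact: prec10.
by exists 0; rewrite nmulr0.
Qed.

(* The sequence of the [oplus (x n) (y n)] need not lie in [calS_set], because
   the size of the corner of [x n] may change with [n]; an interleaving of [x n]
   and [y n] is an equivalent sequence that does. *)
Fact Lambda_add_in_SR (a b : Lambda) :
  a \in SR_set -> b \in SR_set -> Lambda_add a b \in SR_set.
Proof.
move=> /set_mem[x [_ xS] <-] /set_mem[y [_ yS] <-]; apply/mem_set.
pose z n := interleave (val x n) (val y n).
have zT : T_set z.
  move=> n; apply: (block_prec1 _ _ _ (TseqP x n) (TseqP y n)).
  - exact: interleave_block.
  - exact: interleave_block.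
  - exact: evenodd_splits.
exists (exist (fun z => z \in T_set) z (mem_set zT) : Tseq).
  by split=> // n; apply: interleave_absorb.
apply/esym/(@Lambda_addE_block (fun=> evenodd)) => n.
  exact: interleave_block.
exact: evenodd_splits.
Qed.

Definition SR := set_type SR_set.
HB.instance Definition _ := Choice.on SR.
HB.instance Definition _ := SubType.on SR.
HB.instance Definition _ := [SubChoice_isSubPOrder of SR by <: with Lambda_display].

Definition SR0 : SR := exist (fun a => a \in SR_set) Lambda0 Lambda0_in_SR.
Definition SR_add (a b : SR) : SR :=
  exist (fun c => c \in SR_set) (Lambda_add (val a) (val b)) (Lambda_add_in_SR (valP a) (valP b)).
Definition SR_prec (a b : SR) : Prop := Lambda_prec (val a) (val b).

Definition dense_ring : Prop := forall x y : Minf R, x <~1 y ->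
  exists z : Minf R, x <~1 z /\ z <~1 y.

Definition left_normal : Prop := forall a b c : Minf R, a = b ** a -> b = c ** b ->
  exists d e : Minf R, [/\ a = d ** a, d = e ** d & e = c ** e].

End Lambda.

(* Main.v *)
Require Import Defs.
From mathcomp Require Import all_boot all_order all_algebra.
From mathcomp Require Import boolp classical_sets.

(** Everything rests on one computation of suprema. The supremum of an increasing
    sequence of classes [a k] of sequences [x k] is the class of a diagonal
    sequence, and therefore (predicate [limit]) each single term of a
    representative of the supremum lies <~1-below a single term of some [x k].

    It follows that prec implies way-below: if all terms of a sequence are below
    one term [y m] of a second one, whose class is below [sup a], then [y m] is
    below one term of some [x k], so the whole first sequence is below [x k].
    Conversely, suppose that between the terms [y n] and [y n.+2] of any
    representative one can fit a whole sequence of the monoid: one with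
    [y n <~1 z 0] and [z k <~1 y n.+2] for all [k]. The classes of these sequences
    (for even [n]) form a prec-increasing sequence, each term prec the class of
    [y], with that class as supremum. This is (O2). If moreover [a] is way below
    the class of [y], then [a] is below one of these classes, hence prec the class
    of [y]. Since prec and [limit] are statements about single terms, addition is
    compatible with them, because oplus is monotone for <~1; this gives (O3) and
    (O4).

    The section [CuEmbedding] makes this argument for any ordered set embedded in
    Lambda(R) that is stable under the operations and the suprema and admits the
    interpolating sequences. It remains to check the last two properties.

    - In Lambda(R), suprema are [Lambda_limit], and interpolating sequences come
      from iterating density ([dense_interpolate]).
    - In S(R), the diagonal sequence need not satisfy the defining equation
      [w k = y ** w k.+1 ** w k], but it does after right multiplication of its
      terms by suitable elements ([SR_limit]). For the interpolation, the equations
      [x n = u ** x n.+1 ** x n] and [x n.+1 = v ** x n.+2 ** x n.+1] make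
      [x n.+1 ** x n], [x n.+1 ** u] and [v ** x n.+2] a triple to which left
      normality applies, and applying it repeatedly gives the interpolating
      sequence ([left_normal_interpolate], [SR_interpolate]). *)

Set Implicit Arguments.
Unset Strict Implicit.
Unset Printing Implicit Defensive.

Import Order.TTheory GRing.Theory.

Local Open Scope ring_scope.
Local Open Scope quotient_scope.

Definition Tseq_of (R : nonUnitalRingType) (x : nat -> Minf R) (xT : T_set x) : Tseq R :=
  exist (fun z : nat -> Minf R => z \in @T_set R) x (mem_set xT).

(** * Suprema of increasing sequences in Lambda(R) *)

Section Limits.
Variable R : nonUnitalRingType.
Implicit Types (a : nat -> Lambda R) (b c : Lambda R) (x y z : Tseq R).

(** The supremum of an increasing sequence, expressed by single terms of
    representatives. The second condition is stronger than being below every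
    upper bound, and does not refer to other elements of the ordered set; hence it
    can be moved between Lambda(R) and its subsets. *)
Definition limit a b : Prop :=
  (forall k, a k <= b)%O /\
  forall n, exists k m, val (repr b) n <~1 val (repr (a k)) m.

Lemma limit_pi (x : nat -> Tseq R) (w : Tseq R) :
  (forall k, seq_prec (val (x k)) (val w)) ->
  (forall n, exists k m, val w n <~1 val (x k) m) ->
  limit (fun k => \pi_(Lambda R) (x k)) (\pi_(Lambda R) w).
Proof.
move=> xw wx; split=> [k|n]; first exact/Lambda_leE.
have [p np] := (repr_seq_prec w).1 n; have [k [m pm]] := wx p.
have [q mq] := (repr_seq_prec (x k)).2 m.
by exists k, q; apply: prec1_trans np (prec1_trans pm mq).
Qed.

Lemma limit_le a b c : limit a b -> (forall k, a k <= c)%O -> (b <= c)%O.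
Proof.
move=> [_ ba] ac; apply/asboolP => n; have [k [m nm]] := ba n.
have /asboolP/(_ m)[p mp] := ac k.
by exists p; apply: prec1_trans nm mp.
Qed.

Lemma Lambda_prec_le b c : Lambda_prec b c -> (b <= c)%O.
Proof. by move=> [m bm]; apply/asboolP => n; exists m. Qed.

Lemma le_Lambda_prec b b' c : (b <= b')%O -> Lambda_prec b' c -> Lambda_prec b c.
Proof.
move=> /asboolP bb' [m b'm]; exists m => n; have [k nk] := bb' n.
exact: prec1_trans nk (b'm k).
Qed.

Lemma Lambda_prec_limit a b c : Lambda_prec b c -> limit a c ->
  exists k, (b <= a k)%O.
Proof.
move=> [m bm] [_ /(_ m)[k [p mp]]]; exists k; apply/asboolP => n; exists p.
exact: prec1_trans (bm n) mp.
Qed.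

Lemma Lambda_prec_add b b' c c' : Lambda_prec b b' -> Lambda_prec c c' ->
  Lambda_prec (Lambda_add b c) (Lambda_add b' c').
Proof.
move=> [m bm] [p cp]; apply/Lambda_precE; exists (maxn m p).+1 => n /=.
by apply: oplus_prec1; [apply: prec1_trans (bm n) _|apply: prec1_trans (cp n) _];
  apply: Tseq_prec1; rewrite ltnS (leq_maxl, leq_maxr).
Qed.

Lemma limit_add (a a' : nat -> Lambda R) b b' :
  increasing a -> increasing a' -> limit a b -> limit a' b' ->
  limit (fun k => Lambda_add (a k) (a' k)) (Lambda_add b b').
Proof.
move=> a_inc a'_inc [ab ba] [a'b' b'a']; apply: limit_pi => [k|n].
  exact: block_seq_prec (elimT (asboolP _) (ab k)) (elimT (asboolP _) (a'b' k))
    (fun n => oplus_block _ _) (fun n => oplus_block _ _)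
    (fun n => dec_splits _ (leqnn _)).
have [k [m bm]] := ba n; have [k' [m' b'm']] := b'a' n.
pose K := maxn k k'.
have /asboolP/(_ m)[p mp] : (a k <= a K)%O by apply/a_inc/leq_maxl.
have /asboolP/(_ m')[p' mp'] : (a' k' <= a' K)%O by apply/a'_inc/leq_maxr.
exists K, (maxn p p').+1 => /=; apply: oplus_prec1.
  by apply: prec1_trans bm (prec1_trans mp (Tseq_prec1 _ _)); rewrite ltnS leq_maxl.
by apply: prec1_trans b'm' (prec1_trans mp' (Tseq_prec1 _ _)); rewrite ltnS leq_maxr.
Qed.

(** The index [n k.+1] is taken so large that the term [x k.+1 (n k.+1)] of the
    diagonal dominates the finitely many terms with both indices at most [k], so
    that the diagonal is above every [x j]. It also dominates the successor of the
    previous diagonal term: this makes the diagonal increase, and leaves room for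
    the correction of the diagonal in S(R). *)
Lemma diagonal_indices (x : nat -> Tseq R) :
  (forall j k, (j <= k)%N -> seq_prec (val (x j)) (val (x k))) ->
  exists n : nat -> nat, forall k j i, (j <= k)%N -> (i <= maxn k (n k).+1)%N ->
    val (x j) i <~1 val (x k.+1) (n k.+1).
Proof.
move=> x_inc.
have bnd (kN : nat * nat) : exists m, forall j i, (j <= kN.1)%N -> (i <= kN.2)%N ->
    val (x j) i <~1 val (x kN.1.+1) m.
  case: kN => k N /=.
  have /choice[M xM] (ji : nat * nat) : exists m, (ji.1 <= k)%N ->
      val (x ji.1) ji.2 <~1 val (x k.+1) m.
    case: (leqP ji.1 k) => [jk|_]; last by exists 0%N.
    by have [m xm] := x_inc _ _ (leqW jk) ji.2; exists m.
  (* The successor, because <~1 is not reflexive: equal indices would not do. *)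
  exists (\max_(j < k.+1) \max_(i < N.+1) M (val j, val i)).+1 => j i jk iN.
  apply: prec1_trans (xM (j, i) jk) _; apply: Tseq_prec1; rewrite ltnS.
  rewrite -ltnS in jk; rewrite -ltnS in iN.
  apply: leq_trans (leq_bigmax (Ordinal jk)).
  exact: (leq_bigmax (F := fun i : 'I_N.+1 => M (j, val i)) (Ordinal iN)).
have [M xM] := choice bnd.
pose n := nat_rec _ 0%N (fun k p => M (k, maxn k p.+1)).
by exists n => k j i; apply: (xM (k, maxn k (n k).+1)).
Qed.

Lemma Lambda_limit a : increasing a -> exists b, limit a b.
Proof.
move=> a_inc; pose x k := repr (a k).
have [n xn] : exists n : nat -> nat, forall k j i, (j <= k)%N ->
    (i <= maxn k (n k).+1)%N -> val (x j) i <~1 val (x k.+1) (n k.+1).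
  by apply: diagonal_indices => j k /a_inc/asboolP.
pose w k := val (x k) (n k).
have wT : T_set w by move=> k; apply: xn; rewrite ?leq_max ?leqnSn ?orbT.
exists (\pi_(Lambda R) (Tseq_of wT)).
have -> : a = fun k => \pi_(Lambda R) (x k) by apply/funext => k; rewrite reprK.
apply: limit_pi => [k i|k] /=; last by exists k, (n k).+1; apply: TseqP.
by exists (maxn k i).+1; apply: xn; rewrite ?leq_max ?leqnn ?orbT.
Qed.

End Limits.

(** * Cu-semigroups inside Lambda(R) *)

Section CuEmbedding.
Variable R : nonUnitalRingType.
Variables (d : Order.disp_t) (S : porderType d) (zero : S) (add : S -> S -> S).
Variable f : S -> Lambda R.
Hypothesis f_le : forall a b, (f a <= f b)%O = (a <= b)%O.
Hypothesis f_zero : f zero = Lambda0 R.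
Hypothesis f_add : forall a b, f (add a b) = Lambda_add (f a) (f b).
Hypothesis f_limit : forall a : nat -> S, increasing a -> exists b, limit (f \o a) (f b).
Hypothesis f_interpolate : forall b, exists2 y : Tseq R, f b = \pi_(Lambda R) y &
  forall n, exists c (z : Tseq R), [/\ f c = \pi_(Lambda R) z,
    val y n <~1 val z 0%N & forall k, val z k <~1 val y n.+2].

Let f_inj : injective f.
Proof. by move=> a b fab; apply/le_anti; rewrite -!f_le fab lexx. Qed.

Let f_increasing a : increasing a -> increasing (f \o a).
Proof. by move=> a_inc m n /a_inc; rewrite /= f_le. Qed.

Lemma limit_is_sup a b : limit (f \o a) (f b) -> is_sup a b.
Proof.
move=> ab; split=> [_ [k _ <-]|c ac]; first by rewrite -f_le; apply: ab.1.
by rewrite -f_le; apply: limit_le ab _ => k /=; rewrite f_le; apply: ac; exists k.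
Qed.

(** Some limit exists, it is a supremum, and suprema are unique. *)
Lemma is_sup_limit a b : increasing a -> is_sup a b -> limit (f \o a) (f b).
Proof.
move=> /f_limit[c ac] ab.
by rewrite (is_subset1_supremums ab (limit_is_sup ac)).
Qed.

Lemma prec_way_below a b : Lambda_prec (f a) (f b) -> way_below a b.
Proof.
move=> ab z s z_inc /(is_sup_limit z_inc) zs bs.
have fas : Lambda_prec (f a) (f s).
  case: ab => m ab; move: bs; rewrite -f_le => /asboolP/(_ m)[p mp].
  by exists p => n; apply: prec1_trans (ab n) mp.
by have [k /=] := Lambda_prec_limit fas zs; rewrite f_le; exists k.
Qed.

(** Only even [n] are used: the sequence fitted between [y n] and [y n.+2] is
    below the one that starts above [y n.+2]. *)
Lemma prec_approximation b : exists a : nat -> S,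
  [/\ forall n, Lambda_prec (f (a n)) (f (a n.+1)),
      forall n, Lambda_prec (f (a n)) (f b) & limit (f \o a) (f b)].
Proof.
have [y -> /choice[c /choice[z cz]]] := f_interpolate b.
have zy n k : val (z n) k <~1 val y n.+2 by case: (cz n).
have yz n : val y n <~1 val (z n) 0%N by case: (cz n).
exists (fun n => c n.*2); rewrite /comp; split=> [n|n|].
- have [-> _ _] := cz n.*2; have [-> _ _] := cz n.+1.*2.
  apply/Lambda_precE; exists 0%N => k.
  exact: prec1_trans (zy n.*2 k) (yz n.+1.*2).
- by have [-> _ _] := cz n.*2; apply/Lambda_precE; exists n.*2.+2.
rewrite (_ : (fun n => _) = fun n => \pi_(Lambda R) (z n.*2)); last first.
  by apply/funext => n; have [-> _ _] := cz n.*2.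
apply: limit_pi => [n k|n]; first by exists n.*2.+2.
exists n.+1, 0%N; apply: prec1_trans (yz n.+1.*2); apply: Tseq_prec1.
by rewrite -addnn addSn ltnS leq_addr.
Qed.

Lemma prec_wayE a b : Lambda_prec (f a) (f b) <-> way_below a b.
Proof.
split; first exact: prec_way_below.
have [c [c_prec cb c_lim]] := prec_approximation b.
move=> /(_ c b)[||//|m].
- by apply: homo_leq => [x|y x z|n]; rewrite ?lexx //; [apply: le_trans|
    rewrite -f_le; apply: Lambda_prec_le].
- exact: limit_is_sup.
by rewrite -f_le => /le_Lambda_prec/(_ (cb m)).
Qed.

Lemma embedded_Cu_semigroup : Cu_semigroup zero add.
Proof.
have [LA LC L0 Lge0 Lle] := Lambda_pos_monoid R.
split.
- split=> [a b c|a b|a|a|c a b].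
  + by apply: f_inj; rewrite !f_add LA.
  + by apply: f_inj; rewrite !f_add LC.
  + by apply: f_inj; rewrite f_add f_zero L0.
  + by rewrite -f_le f_zero.
  + by rewrite -!f_le !f_add; apply: Lle.
- by move=> a /f_limit[b ab]; exists b; apply: limit_is_sup.
- move=> b; have [a [a_prec _ ab]] := prec_approximation b.
  by exists a; split=> [n|]; [apply: prec_way_below|apply: limit_is_sup].
- move=> a' a b' b /prec_wayE aa' /prec_wayE bb'; apply/prec_wayE.
  by rewrite !f_add; apply: Lambda_prec_add.
- move=> a b s t a_inc b_inc /(is_sup_limit a_inc) als /(is_sup_limit b_inc) blt.
  apply: limit_is_sup; rewrite f_add /comp; under eq_fun do rewrite f_add.
  by apply: limit_add als blt; apply: f_increasing.
Qed.

End CuEmbedding.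

(** * Dense rings *)

(** Interpolation between the last element found and the fixed upper bound [y]
    can be repeated for ever. *)
Lemma dense_interpolate (R : nonUnitalRingType) (x y : Minf R) :
  dense_ring R -> x <~1 y ->
  exists z : Tseq R, x <~1 val z 0%N /\ forall k, val z k <~1 y.
Proof.
move=> R_dense xy.
have /choice[g gP] (u : Minf R) : exists v, u <~1 y -> u <~1 v /\ v <~1 y.
  have [uy|] := pselect (u <~1 y); last by exists 0.
  by have [v uvy] := R_dense _ _ uy; exists v.
pose z k := iter k.+1 g x.
have zy k : z k <~1 y by elim: k => [|k IHk]; apply: (gP _ _).2.
have zT : T_set z by move=> k; apply: (gP _ (zy k)).1.
exists (Tseq_of zT); split=> //=.
exact: (gP _ xy).1.
Qed.

(** * Left normal rings *)

Section LeftNormal.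
Variable R : nonUnitalRingType.

(** If [x k (n k).+1 = s k ** x k.+1 (n k.+1) ** t k], replace the diagonal term
    [x k.+1 (n k.+1)] by [w k], its product with [t k]. Then
    [x k (n k).+1 = s k ** w k], so that the relation
    [x k (n k) = y ** x k (n k).+1 ** x k (n k)], which survives right
    multiplication, turns into one between consecutive terms of [w]. *)
Lemma SR_limit (a : nat -> SR R) : increasing a ->
  exists b : SR R, limit (fun k => val (a k)) (val b).
Proof.
move=> a_inc.
have /choice[x xP] k : exists x : Tseq R,
    calS_set (val x) /\ \pi_(Lambda R) x = val (a k).
  by have [x ? ?] := set_mem (valP (a k)); exists x.
have x_inc j k : (j <= k)%N -> seq_prec (val (x j)) (val (x k)).
  by move=> /a_inc; rewrite -Order.le_val -!(xP _).2 => /Lambda_leE.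
have [n xn] := diagonal_indices x_inc.
have xSn k : val (x k) (n k).+1 <~1 val (x k.+1) (n k.+1).
  by apply: xn => //; rewrite leq_maxr.
have [s /choice[t st]] := choice xSn.
have /choice[y yE] k : exists y, val (x k) (n k) =
    y ** val (x k) (n k).+1 ** val (x k) (n k) by apply: (xP k).1.2.
pose w k := val (x k.+1) (n k.+1) ** t k.
have sw k : val (x k) (n k).+1 = s k ** w k by rewrite /w nmulA.
have wE k : w k = (y k.+1 ** s k.+1) ** w k.+1 ** w k.
  by rewrite -(nmulA (y _)) -sw /w nmulA -yE.
have xw k : val (x k) (n k) <~1 w k.
  by exists (y k ** s k), (val (x k) (n k)); rewrite -(nmulA (y k)) -sw -yE.
have wT : T_set w by move=> k; exists (y k.+1 ** s k.+1), (w k).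
have bS : \pi_(Lambda R) (Tseq_of wT) \in @SR_set R.
  apply/mem_set; exists (Tseq_of wT) => //; split=> // k.
  by exists (y k.+1 ** s k.+1).
exists (exist (fun b : Lambda R => b \in @SR_set R) _ bS).
rewrite (_ : (fun k => _) = fun k => \pi_(Lambda R) (x k)); last first.
  by apply/funext => k; rewrite (xP k).2.
apply: limit_pi => [k i|k] /=.
  exists (maxn k i).+1; apply: prec1_trans (xw _); apply: xn; rewrite ?leq_maxl //.
  by rewrite leq_max leq_maxr.
exists k.+1, (n k.+1).+1, (y k.+1), (w k).
by rewrite /w nmulA -yE.
Qed.

(** Left normality for [(a, b, c)] gives [d] and [e], and then applies to
    [(d, e, c)]: the [e] part stays fixed by [c] and provides the [b] of the next
    application, while the [d] parts form the sequence. *)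
Lemma left_normal_interpolate (a b c : Minf R) : left_normal R ->
  a = b ** a -> b = c ** b ->
  exists z : nat -> Minf R, [/\ a = z 0%N ** a,
    forall k, z k = z k.+1 ** z k & forall k, z k = c ** z k].
Proof.
move=> R_normal ab bc.
have [d [e [ad de ec]]] := R_normal _ _ _ ab bc.
have /choice[g gP] (p : Minf R * Minf R) : exists q : Minf R * Minf R,
    p.1 = p.2 ** p.1 -> p.2 = c ** p.2 ->
    [/\ p.1 = q.1 ** p.1, q.1 = q.2 ** q.1 & q.2 = c ** q.2].
  have [[p12 p2]|np] := pselect (p.1 = p.2 ** p.1 /\ p.2 = c ** p.2).
    by have [d' [e' ?]] := R_normal _ _ _ p12 p2; exists (d', e').
  by exists p => p12 p2; case: np.
pose p k := iter k g (d, e).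
have pP k : (p k).1 = (p k).2 ** (p k).1 /\ (p k).2 = c ** (p k).2.
  by elim: k => [//|k [IH1 IH2]]; have [] := gP _ IH1 IH2.
exists (fun k => (p k).1); split=> // k.
  by have [] := gP _ (pP k).1 (pP k).2.
by rewrite (pP k).1 nmulA -(pP k).2.
Qed.

Lemma SR_interpolate (b : SR R) : left_normal R ->
  exists2 y : Tseq R, val b = \pi_(Lambda R) y &
  forall n, exists (c : SR R) (z : Tseq R), [/\ val c = \pi_(Lambda R) z,
    val y n <~1 val z 0%N & forall k, val z k <~1 val y n.+2].
Proof.
move=> R_normal; have [x [_ xS] xb] := set_mem (valP b).
exists x => // n; have [u uE] := xS n; have [v vE] := xS n.+1.
set x0 := val x n in uE *; set x1 := val x n.+1 in uE vE.
set x2 := val x n.+2 in vE *.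
(* The factor [x1] on the left of [x0] turns [x0 = u ** x1 ** x0] into an equation
   [a = b ** a]; multiplying by [u] recovers [x0] from [x1 ** x0]. *)
have [|| z [x10 zE zc]] :=
  @left_normal_interpolate (x1 ** x0) (x1 ** u) (v ** x2) R_normal.
- by rewrite {1}uE !nmulA.
- by rewrite nmulA -vE.
have zS k : exists y, z k = y ** z k.+1 ** z k.
  by exists (z k.+1); rewrite -nmulA -!zE.
have zT : T_set z by move=> k; have [y yE] := zS k; exists y, (z k).
have cS : \pi_(Lambda R) (Tseq_of zT) \in @SR_set R.
  by apply/mem_set; exists (Tseq_of zT).
exists (exist (fun b : Lambda R => b \in @SR_set R) _ cS), (Tseq_of zT); split=> //= [|k].
  by exists u, (x1 ** x0); rewrite -nmulA -x10 nmulA.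
by exists v, (z k).
Qed.

End LeftNormal.

Theorem theorem7p8 (R : nonUnitalRingType) :
  (dense_ring R ->
     Cu_semigroup (Lambda0 R) (@Lambda_add R) /\
     (forall a b : Lambda R, Lambda_prec a b <-> way_below a b)) /\
  (left_normal R ->
     Cu_semigroup (SR0 R) (@SR_add R) /\
     (forall a b : SR R, SR_prec a b <-> way_below a b)).
Proof.
split=> [R_dense|R_normal].
  have inter (b : Lambda R) : exists2 y : Tseq R, b = \pi_(Lambda R) y &
      forall n, exists (c : Lambda R) (z : Tseq R), [/\ c = \pi_(Lambda R) z,
        val y n <~1 val z 0%N & forall k, val z k <~1 val y n.+2].
    exists (repr b) => [|n]; first by rewrite reprK.
    have [z [yz zy]] := dense_interpolate R_dense (TseqP (repr b) n).
    exists (\pi_(Lambda R) z), z; split=> // k.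
    exact: prec1_trans (zy k) (TseqP _ _).
  have le_id (a b : Lambda R) : (id a <= id b)%O = (a <= b)%O by [].
  split; last exact: (prec_wayE le_id (@Lambda_limit R) inter).
  exact: (embedded_Cu_semigroup le_id erefl (fun _ _ => erefl)
    (@Lambda_limit R) inter).
have val_le (a b : SR R) : (val a <= val b)%O = (a <= b)%O by rewrite Order.le_val.
split.
  apply: (embedded_Cu_semigroup (f := fun a : SR R => val a) val_le) => //.
  - exact: SR_limit.
  - by move=> b; apply: SR_interpolate.
apply: (prec_wayE val_le); first exact: SR_limit.
by move=> b; apply: SR_interpolate.
Qed.
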